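(* For every countable ordinal $\alpha$ there exists a well-quasi-ordered prime interval order $P_\alpha$ whose chain $AM(P_\alpha)_{\le}$ of maximal antichains has Hausdorff rank $\alpha$.
   Context: A poset is an interval order if it is isomorphic to a set of nonempty intervals of some chain, ordered by $I<J$ iff $x<y$ for all $x\in I$, $y\in J$. A module of a poset $(V,\le)$ is a subset $A\subseteq V$ such that for all $a,a'\in A$ and $x\notin A$: $x\le a\iff x\le a'$ and $a\le x\iff a'\le x$; the poset is prime if its only modules are $\varnothing$, singletons and $V$. A poset is well-quasi-ordered if it has no infinite strictly descending chain and no infinite antichain. $AM(P)$ is the set of maximal antichains of $P$ ordered by $A\le B$ iff every $a\in A$ is below some $b\in B$; for an interval order it is a chain. Hausdorff rank of scattered chains: chains of rank $0$ are the finite chains and the chains of order type $\omega$, $\omega^*$ and $\mathbb{Z}$; a scattered chain has rank $\alpha$ if $\alpha$ is the least ordinal such that it is a linear sum, indexed by a chain of rank $0$, of chains of rank $<\alpha$ (every scattered chain decomposes as such a sum of chains of strictly lesser rank). *)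

(* Defs.v *)
From Stdlib Require Import Relations Relation_Operators Wellfounded FinFun.
From Stdlib Require Import ZArith Qcanon.
From Stdlib Require Import FunctionalExtensionality PropExtensionality ProofIrrelevance.

Record poset := Poset {
  carrier :> Type;
  ple : relation carrier;
  ple_order : order carrier ple }.

Arguments ple {p} _ _.

Definition plt {P : poset} (x y : P) : Prop := ple x y /\ x <> y.

Definition is_chain (P : poset) : Prop := forall x y : P, ple x y \/ ple y x.

Definition order_iso {A B : Type} (R : relation A) (S : relation B) : Prop :=
  exists f : A -> B, Bijective f /\ forall x y, R x y <-> S (f x) (f y).

Definition interval {C : poset} (I : C -> Prop) : Prop :=
  forall x y z, I x -> I z -> ple x y -> ple y z -> I y.

(* The second clause makes [f] injective, up to extensional equality of the
   intervals: [P] is isomorphic to a set, not a multiset, of intervals. *)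
Definition interval_order (P : poset) : Prop :=
  exists (C : poset) (f : P -> C -> Prop),
    is_chain C /\
    (forall p q, (forall x, f p x <-> f q x) -> p = q) /\
    (forall p, (exists x, f p x) /\ interval (f p)) /\
    (forall p q, plt p q <-> forall x y, f p x -> f q y -> plt x y).

Definition module {P : poset} (A : P -> Prop) : Prop :=
  forall a a' x, A a -> A a' -> ~ A x ->
    (ple x a <-> ple x a') /\ (ple a x <-> ple a' x).

Definition prime (P : poset) : Prop :=
  forall A : P -> Prop, module A ->
    (forall x, ~ A x) \/ (exists v, forall x, A x <-> x = v) \/ (forall x, A x).

Definition wqo (P : poset) : Prop :=
  (~ exists f : nat -> P, forall n, plt (f (S n)) (f n)) /\
  (~ exists f : nat -> P, forall m n, m <> n -> ~ ple (f m) (f n)).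

Definition antichain {P : poset} (A : P -> Prop) : Prop :=
  forall x y, A x -> A y -> ple x y -> x = y.

Definition maximal_antichain {P : poset} (A : P -> Prop) : Prop :=
  antichain A /\
  forall B, antichain B -> (forall x, A x -> B x) -> forall x, B x -> A x.

Definition AM_carrier (P : poset) : Type :=
  {A : P -> Prop | maximal_antichain A}.

Definition AM_le {P : poset} (A B : AM_carrier P) : Prop :=
  forall a, proj1_sig A a -> exists b, proj1_sig B b /\ ple a b.

Lemma AM_order (P : poset) : order (AM_carrier P) AM_le.
Proof.
destruct (ple_order P) as [Hr Ht Ha].
assert (Hsub : forall A B : AM_carrier P, AM_le A B -> AM_le B A ->
  forall x, proj1_sig A x -> proj1_sig B x).
{ intros A B AB BA x Ax.
  destruct (AB x Ax) as (b & Bb & xb); destruct (BA b Bb) as (a & Aa & ba).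
  assert (x = a) as <-.
  { apply (proj1 (proj2_sig A)); auto. eapply Ht; eauto. }
  now rewrite (Ha x b xb ba). }
split.
- intros A a Aa; exists a; split; auto; apply Hr.
- intros A B C AB BC a Aa.
  destruct (AB a Aa) as (b & Bb & ab); destruct (BC b Bb) as (c & Cc & bc).
  exists c; split; auto; eapply Ht; eauto.
- intros A B AB BA.
  assert (E : proj1_sig A = proj1_sig B).
  { extensionality x; apply propositional_extensionality; split; apply Hsub; auto. }
  destruct A as [A HA], B as [B HB]; simpl in E; subst B.
  now rewrite (proof_irrelevance _ HA HB).
Qed.

Definition AM (P : poset) : poset := Poset (AM_carrier P) AM_le (AM_order P).

(* Ordinals are represented by well-ordered types, considered up to isomorphism. *)
Record ordinal := Ordinal {
  ord_carrier :> Type;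
  olt : relation ord_carrier;
  olt_wf : well_founded olt;
  olt_trans : transitive ord_carrier olt;
  olt_total : forall x y, olt x y \/ x = y \/ olt y x }.

Arguments olt {o} _ _.

(* [b] is isomorphic to a proper initial segment of [a]. *)
Definition ord_lt (b a : ordinal) : Prop :=
  exists (f : b -> a) (x : a),
    (forall y z, olt y z -> olt (f y) (f z)) /\
    (forall w, olt w x <-> exists y, f y = w).

Definition ord_zero (a : ordinal) : Prop := a -> False.

Definition ord_countable (a : ordinal) : Prop := exists f : a -> nat, Injective f.

Definition scattered_chain (C : poset) : Prop :=
  is_chain C /\
  ~ exists f : Qc -> C, forall x y, Qcle x y <-> ple (f x) (f y).

Definition rank_zero_chain (C : poset) : Prop :=
  (is_chain C /\ Finite C) \/
  order_iso (@ple C) Nat.le \/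
  order_iso (@ple C) (fun m n => Nat.le n m) \/
  order_iso (@ple C) Z.le.

(* Order of the linear sum of the [F i] along [I]. *)
Definition linear_sum_le {I : poset} (F : I -> poset) : relation {i : I & F i} :=
  lexprod I (fun i => F i) plt (fun i => @ple (F i)).

(* Cumulative classes: [hausdorff_class a C] says that [a] is one of the ordinals
   over which the Hausdorff rank of [C] is the minimum.  Hence a chain has rank
   less than [a] iff it lies in the class of some [b] less than [a], which is the
   condition imposed on the summands. *)
Inductive hausdorff_class : ordinal -> poset -> Prop :=
| hausdorff_class_zero (a : ordinal) (C : poset) :
    ord_zero a -> rank_zero_chain C -> hausdorff_class a C
| hausdorff_class_sum (a : ordinal) (C I : poset)
    (F : I -> poset) (b : I -> ordinal) :
    rank_zero_chain I ->
    (forall i, ord_lt (b i) a) ->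
    (forall i, hausdorff_class (b i) (F i)) ->
    order_iso (@ple C) (linear_sum_le F) ->
    hausdorff_class a C.

Definition hausdorff_rank (C : poset) (a : ordinal) : Prop :=
  scattered_chain C /\ hausdorff_class a C /\
  forall b, ord_lt b a -> ~ hausdorff_class b C.

(* Main.v *)
(* By transfinite induction there is a countable well-ordered chain K without
   maximum of rank a (of type omega^(1+a)): an omega-sum of such chains for the
   ordinals below a, each of them repeated infinitely often.  Its rank is not
   smaller: if K embeds in a chain of class b < a, some summand of class >= b is
   bounded in the image, so it eventually lies in a single piece of class < b.

   A set of intervals of K containing all the points {i} has its maximal
   antichains in bijection with K, the antichain of i being the set of intervals
   containing i.  Enumerate K, starting with its first two elements, and add the
   intervals [l(j), j], where l(j) is the largest element of K which precedes j
   both in K and in the enumeration.  Each point lies in finitely many of them,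
   hence no infinite antichain; and they link every j > 0 to a smaller element,
   which forces every module with two elements to be everything. *)

From Stdlib Require Import QArith Qcanon.
From Stdlib Require Import Arith Cantor List Lia.
From Stdlib Require Import Relations Wellfounded FinFun.
From Stdlib Require Import ClassicalEpsilon ProofIrrelevance.
From Stdlib Require Import FunctionalExtensionality PropExtensionality.
Require Import Defs.

Local Open Scope nat_scope.

(** * Posets and well-founded chains *)

Lemma ple_refl (C : poset) (x : C) : ple x x.
Proof. apply (ord_refl _ _ (ple_order C)). Qed.

Lemma ple_trans (C : poset) (x y z : C) : ple x y -> ple y z -> ple x z.
Proof. apply (ord_trans _ _ (ple_order C)). Qed.

Lemma ple_antisym (C : poset) (x y : C) : ple x y -> ple y x -> x = y.
Proof. apply (ord_antisym _ _ (ple_order C)). Qed.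

Lemma plt_irrefl (C : poset) (x : C) : ~ plt x x.
Proof. now intros [_ H]. Qed.

Lemma ple_plt_trans (C : poset) (x y z : C) : ple x y -> plt y z -> plt x z.
Proof.
intros Hxy [Hyz N]; split; [now apply ple_trans with y|].
intros ->; now apply N, ple_antisym.
Qed.

Lemma plt_ple_trans (C : poset) (x y z : C) : plt x y -> ple y z -> plt x z.
Proof.
intros [Hxy N] Hyz; split; [now apply ple_trans with y|].
intros ->; now apply N, ple_antisym.
Qed.

Lemma plt_trans (C : poset) (x y z : C) : plt x y -> plt y z -> plt x z.
Proof. intros H [K _]; now apply plt_ple_trans with y. Qed.

Lemma plt_not_ple (C : poset) (x y : C) : plt x y -> ~ ple y x.
Proof. intros [H N] K; now apply N, ple_antisym. Qed.

Lemma not_ple_plt (C : poset) (x y : C) : is_chain C -> ~ ple x y -> plt y x.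
Proof.
intros Hc N; destruct (Hc x y) as [H|H]; [easy|].
split; [easy|]; intros ->; apply N, ple_refl.
Qed.

Lemma ple_eq_or_plt (C : poset) (x y : C) : ple x y -> x = y \/ plt x y.
Proof. intros H; destruct (classic (x = y)); [now left|now right]. Qed.

Lemma plt_trichotomy (C : poset) (x y : C) :
  is_chain C -> plt x y \/ x = y \/ plt y x.
Proof.
intros Hc; destruct (Hc x y) as [H|H]; apply ple_eq_or_plt in H as [->|H]; auto.
Qed.

Lemma wf_minimal (C : poset) (Q : C -> Prop) :
  is_chain C -> well_founded (@plt C) -> (exists x, Q x) ->
  exists m, Q m /\ forall x, Q x -> ple m x.
Proof.
intros Hc Hw [x Qx]; induction (Hw x) as [x _ IH].
destruct (classic (exists y, plt y x /\ Q y)) as [(y & Hy & Qy)|N].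
- now apply (IH y).
- exists x; split; [easy|]; intros y Qy; apply NNPP; intros Hn.
  apply N; exists y; split; [now apply not_ple_plt|easy].
Qed.

Lemma no_descending (C : poset) :
  well_founded (@plt C) -> ~ exists f : nat -> C, forall n, plt (f (S n)) (f n).
Proof.
intros Hw [f Hf].
assert (H : forall x n, f n <> x).
{ intros x; induction (Hw x) as [x _ IH]; intros n <-.
  now apply (IH (f (S n)) (Hf n) (S n)). }
now apply (H (f 0) 0).
Qed.

Lemma order_iso_sym (A B : Type) (R : relation A) (S : relation B) :
  order_iso R S -> order_iso S R.
Proof.
intros (f & (g & gf & fg) & Hf); exists g; split.
- now exists f.
- intros x y; rewrite (Hf (g x) (g y)); now rewrite !fg.
Qed.

Lemma wf_chain_scattered (C : poset) :
  is_chain C -> well_founded (@plt C) -> scattered_chain C.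
Proof.
intros Hc Hw; split; [easy|]; intros [f Hf].
apply (no_descending C Hw).
(* The images of 0, -1, -2, ... would descend forever. *)
exists (fun n => f (Q2Qc (inject_Z (- Z.of_nat n)))); intros n.
assert (L : Qclt (Q2Qc (inject_Z (- Z.of_nat (S n))))
                 (Q2Qc (inject_Z (- Z.of_nat n)))).
{ unfold Qclt, Q2Qc, this; rewrite !Qred_correct, <- Zlt_Qlt; lia. }
apply not_ple_plt; [easy|]; rewrite <- Hf; now apply Qclt_not_le.
Qed.

(** * Ordinals and their initial segments *)

Lemma olt_irrefl (a : ordinal) (x : a) : ~ olt x x.
Proof. intros H; induction (olt_wf a x) as [x _ IH]; eauto. Qed.

Definition seg (a : ordinal) (x : a) : ordinal.
Proof.
refine (Ordinal {y : a | olt y x} (fun y z => olt (proj1_sig y) (proj1_sig z)) _ _ _).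
- apply (wf_inverse_image _ _ _ (@proj1_sig _ _) (olt_wf a)).
- intros y z w; apply olt_trans.
- intros [y Hy] [z Hz]; cbn.
  destruct (olt_total a y z) as [H|[->|H]]; auto.
  right; left; f_equal; apply proof_irrelevance.
Defined.

Lemma seg_lt (a : ordinal) (x : a) : ord_lt (seg a x) a.
Proof.
exists (@proj1_sig _ _), x; split; [easy|]; intros w; split.
- intros H; now exists (exist _ w H).
- now intros [[y Hy] <-].
Qed.

(** Passes from [b] to the segment of [a] isomorphic to it, without identifying isomorphic
    ordinals. *)
Lemma ord_lt_seg (c b a : ordinal) (f : b -> a) (x : a) :
  (forall y z, olt y z -> olt (f y) (f z)) ->
  (forall w, olt w x <-> exists y, f y = w) ->
  ord_lt c b -> ord_lt c (seg a x).
Proof.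
intros Hf Hx (g & y & Hg & Hy).
assert (Hlt : forall z, olt (f z) x) by (intros z; apply Hx; eauto).
exists (fun z => exist _ (f (g z)) (Hlt (g z)) : seg a x).
exists (exist _ (f y) (Hlt y)); split.
- intros u v H; now apply Hf, Hg.
- intros [w Hw]; cbn; split.
  + intros H; destruct (proj1 (Hx w) Hw) as [v <-].
    assert (Hv : olt v y).
    { destruct (olt_total b v y) as [L|[->|L]]; [easy| |]; exfalso.
      - now apply olt_irrefl in H.
      - now apply (olt_irrefl a (f v)), (olt_trans a _ (f y)), Hf. }
    destruct (proj1 (Hy v) Hv) as [u <-]; exists u.
    f_equal; apply proof_irrelevance.
  + intros [u Hu]; apply (f_equal (@proj1_sig _ _)) in Hu; cbn in Hu; subst w.
    apply Hf, Hy; eauto.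
Qed.

(** Each [seg a x] is accessible by induction on [x]. An ordinal below it is isomorphic, not equal,
    to some [seg a y], so accessibility is checked one level further down, through [ord_lt_seg]. *)
Lemma ord_lt_wf : well_founded ord_lt.
Proof.
assert (H : forall (a : ordinal) (x : a), Acc ord_lt (seg a x)).
{ intros a x; induction (olt_wf a x) as [x _ IH].
  constructor; intros b (f & [y Hy] & Hf & Hr); cbn in *.
  constructor; intros c Hc; apply (IH y Hy).
  apply (ord_lt_seg c b a (fun z => proj1_sig (f z)) y); [easy| |easy].
  intros w; split.
  - intros Hw.
    destruct (proj1 (Hr (exist _ w (olt_trans a _ _ _ Hw Hy))) Hw) as [u Hu].
    exists u; now rewrite Hu.
  - intros [u <-]; apply (proj2 (Hr (f u))); eauto. }
intros a; constructor; intros b (f & x & Hf & Hx); constructor; intros c Hc.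
apply (H a x), (ord_lt_seg c b a f x Hf Hx Hc).
Qed.

(** * Bounded maps into chains of rank zero *)

(** Climbing below [hi] must stop: in omega and Z the distance to [hi] decreases, in the reverse of
    omega the number itself, and in a finite chain a list covering the larger elements gets
    shorter. *)
Lemma rank_zero_acc (I : poset) (hi : I) :
  rank_zero_chain I -> well_founded (fun y x : I => plt x y /\ ple y hi).
Proof.
assert (M : forall m : I -> nat, (forall x y, plt x y -> ple y hi -> m y < m x) ->
  well_founded (fun y x : I => plt x y /\ ple y hi)).
{ intros m Hm; apply (wf_incl _ _ (fun y x => m y < m x)).
  - intros y x [H K]; auto.
  - apply well_founded_ltof. }
intros [[_ [l Hl]]|[(f & (g & gf & fg) & Hf)|[(f & (g & gf & fg) & Hf)|(f & (g & gf & fg) & Hf)]]].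
- assert (H : forall n (k : list I) x, length k <= n ->
    (forall y, plt x y -> In y k) -> Acc (fun y x : I => plt x y /\ ple y hi) x).
  { intros n; induction n as [|n IH]; intros k x Hn Hk;
      constructor; intros y [Hxy _]; pose proof (Hk y Hxy) as Hy.
    - destruct k; [easy|cbn in Hn; lia].
    - apply in_split in Hy as (k1 & k2 & ->).
      apply (IH (k1 ++ k2)).
      + rewrite length_app in *; cbn in Hn; lia.
      + intros z Hz; specialize (Hk z (plt_trans _ _ _ _ Hxy Hz)).
        apply in_app_iff in Hk as [Hk|[->|Hk]]; [apply in_app_iff; auto| |
          apply in_app_iff; auto].
        now apply plt_irrefl in Hz. }
  intros x; apply (H _ l x (le_n _)); intros y _; apply Hl.
- apply (M (fun x => f hi - f x)); intros x y [Hxy N] Hy.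
  apply Hf in Hxy, Hy.
  assert (f x <> f y) by (intros E; apply N; rewrite <- (gf x), <- (gf y); congruence).
  lia.
- apply (M f); intros x y [Hxy N] Hy.
  apply Hf in Hxy.
  assert (f x <> f y) by (intros E; apply N; rewrite <- (gf x), <- (gf y); congruence).
  lia.
- apply (M (fun x => Z.to_nat (f hi - f x))); intros x y [Hxy N] Hy.
  apply Hf in Hxy, Hy.
  assert (f x <> f y) by (intros E; apply N; rewrite <- (gf x), <- (gf y); congruence).
  lia.
Qed.

(** Each change of value is a strict step upwards below [hi], so [rank_zero_acc] allows only
    finitely many. *)
Lemma bounded_eventually_constant (K I : poset) (h : K -> I) (hi : I) (k0 : K) :
  rank_zero_chain I ->
  (forall x y, ple x y -> ple (h x) (h y)) -> (forall x, ple (h x) hi) ->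
  exists t, forall k, ple t k -> h k = h t.
Proof.
intros HI Hm Hb; remember (h k0) as i eqn:E; revert k0 E.
induction (rank_zero_acc I hi HI i) as [i _ IH]; intros k0 ->.
destruct (classic (exists k, ple k0 k /\ h k <> h k0)) as [(k & Hk & N)|N].
- apply (IH (h k)) with k; [|easy].
  split; [split; [now apply Hm|congruence]|apply Hb].
- exists k0; intros k Hk; apply NNPP; intros H; apply N; eauto.
Qed.

(** * Linear sums of chains *)

Definition omega : poset.
Proof.
refine (Poset nat Nat.le _); split.
- exact Nat.le_refl.
- exact Nat.le_trans.
- exact Nat.le_antisymm.
Defined.

Lemma omega_chain : is_chain omega.
Proof. intros x y; apply Nat.le_ge_cases. Qed.

Lemma omega_plt (m n : omega) : plt m n <-> m < n.
Proof. unfold plt; cbn; split; [intros [H N]|intros H; split]; cbn in *; lia. Qed.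

Lemma linear_sum_le_diff (I : poset) (F : I -> poset) (i j : I) (x : F i) (y : F j) :
  plt i j -> linear_sum_le F (existT _ i x) (existT _ j y).
Proof. intros H; now apply left_lex. Qed.

Lemma linear_sum_le_same (I : poset) (F : I -> poset) (i : I) (x y : F i) :
  linear_sum_le F (existT _ i x) (existT _ i y) <-> ple x y.
Proof.
split; [|intros H; exact (right_lex I (fun i => F i) plt (fun i => @ple (F i)) i x y H)].
intros H; inversion H; subst.
- now destruct (plt_irrefl I i).
- repeat match goal with E : existT _ _ _ = existT _ _ _ |- _ =>
    apply inj_pair2 in E end; now subst.
Qed.

Lemma linear_sum_le_index (I : poset) (F : I -> poset) (u v : {i : I & F i}) :
  linear_sum_le F u v -> ple (projT1 u) (projT1 v).
Proof. intros [? ? ? ? [H _]|? ? ? _]; [exact H|apply ple_refl]. Qed.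

Lemma linear_sum_le_inv (I : poset) (F : I -> poset) (i j : I) (x : F i) (y : F j) :
  linear_sum_le F (existT _ i x) (existT _ j y) -> plt i j \/ i = j.
Proof. intros H; apply linear_sum_le_index, ple_eq_or_plt in H as [H|H]; auto. Qed.

Lemma linear_sum_order (I : poset) (F : I -> poset) : order _ (linear_sum_le F).
Proof.
split.
- intros [i x]; apply linear_sum_le_same, ple_refl.
- intros [i x] [j y] [k z] H1 H2.
  destruct (linear_sum_le_inv _ _ _ _ _ _ H1) as [L1|<-].
  + apply linear_sum_le_diff, (plt_ple_trans _ _ _ _ L1).
    apply (linear_sum_le_index _ _ _ _ H2).
  + destruct (linear_sum_le_inv _ _ _ _ _ _ H2) as [L2|<-].
    * now apply linear_sum_le_diff.
    * rewrite linear_sum_le_same in *; now apply ple_trans with y.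
- intros [i x] [j y] H1 H2.
  assert (E : i = j) by
    exact (ple_antisym _ _ _ (linear_sum_le_index _ _ _ _ H1)
                             (linear_sum_le_index _ _ _ _ H2)).
  subst j; rewrite linear_sum_le_same in *; f_equal; now apply ple_antisym.
Qed.

Definition linear_sum (I : poset) (F : I -> poset) : poset :=
  Poset {i : I & F i} (linear_sum_le F) (linear_sum_order I F).

Lemma linear_sum_chain (I : poset) (F : I -> poset) :
  is_chain I -> (forall i, is_chain (F i)) -> is_chain (linear_sum I F).
Proof.
intros HI HF [i x] [j y].
destruct (plt_trichotomy I i j HI) as [H|[<-|H]].
- left; now apply linear_sum_le_diff.
- destruct (HF i x y); [left|right]; now apply linear_sum_le_same.
- right; now apply linear_sum_le_diff.
Qed.

Lemma linear_sum_wf (I : poset) (F : I -> poset) :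
  well_founded (@plt I) -> (forall i, well_founded (@plt (F i))) ->
  well_founded (@plt (linear_sum I F)).
Proof.
intros HI HF.
apply (wf_incl _ _ (lexprod I (fun i => F i) plt (fun i => @plt (F i)))).
- intros [i x] [j y] [H N].
  destruct (linear_sum_le_inv _ _ _ _ _ _ H) as [L|<-].
  + now apply left_lex.
  + apply right_lex; apply linear_sum_le_same in H; split; [easy|congruence].
- now apply wf_lexprod.
Qed.

(** * Well-ordered chains of prescribed Hausdorff rank *)

(* Lower bounds on the Hausdorff rank are inherited by final segments, so they
   are stated for maps which are strictly increasing from some point on. *)
Definition tail_embedding (K D : poset) (t : K) (g : K -> D) : Prop :=
  forall x y, ple t x -> plt x y -> plt (g x) (g y).

(** [op_upper] speaks of all copies of [C], so that it applies directly to the chain of maximal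
    antichains. [op_no_max] keeps strictly increasing maps from becoming constant, and later
    provides successors. *)
Record omega_power (a : ordinal) (C : poset) : Prop := {
  op_chain : is_chain C;
  op_wf : well_founded (@plt C);
  op_countable : exists f : C -> nat, Injective f;
  op_inhabited : inhabited C;
  op_no_max : forall x : C, exists y, plt x y;
  op_upper : forall D, order_iso (@ple D) (@ple C) -> hausdorff_class a D;
  op_lower : forall b (D : poset) (t : C) (g : C -> D), ord_lt b a -> hausdorff_class b D ->
    ~ tail_embedding C D t g }.

Lemma eventually_constant_not_embedding (K D : poset) (t : K) (g : K -> D) :
  (forall x : K, exists y, plt x y) ->
  (forall x y, plt x y -> plt (g x) (g y)) ->
  ~ forall k, ple t k -> g k = g t.
Proof.
intros Hn Hg He; destruct (Hn t) as [y Hy].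
apply (plt_irrefl _ (g t)); rewrite <- (He y) at 2; [now apply Hg|apply Hy].
Qed.

(* If a block [K] without maximum embeds below a point of a chain of class [b],
   then its index along the sum is eventually constant. *)
Lemma bounded_block (b : ordinal) (K D : poset) (g : K -> D) (hi : D) :
  inhabited K -> (forall x : K, exists y, plt x y) ->
  hausdorff_class b D ->
  (forall x y, plt x y -> plt (g x) (g y)) -> (forall x, ple (g x) hi) ->
  exists (c : ordinal) (E : poset) (t : K) (h : K -> E),
    ord_lt c b /\ hausdorff_class c E /\ tail_embedding K E t h.
Proof.
intros [k0] Hn HD Hg Hb.
assert (Hm : forall x y, ple x y -> ple (g x) (g y)).
{ intros x y H; apply ple_eq_or_plt in H as [->|H]; [apply ple_refl|now apply Hg]. }
destruct HD as [b D _ HD|b D I F c HI Hc HF (phi & (psi & pp & _) & Hphi)].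
- destruct (bounded_eventually_constant K D g hi k0 HD Hm Hb) as [t Ht].
  now destruct (eventually_constant_not_embedding K D t g Hn Hg).
- destruct (bounded_eventually_constant K I (fun k => projT1 (phi (g k)))
    (projT1 (phi hi)) k0 HI) as [t Ht].
  + intros x y H; apply linear_sum_le_index, Hphi; auto.
  + intros x; apply linear_sum_le_index, Hphi; auto.
  + set (i := projT1 (phi (g t))) in *.
    (* Before [t] the value is a placeholder, since [tail_embedding] only looks beyond [t]. *)
    assert (Hh : forall k, exists y : F i, ple t k -> phi (g k) = existT _ i y).
    { intros k; destruct (classic (ple t k)) as [H|H].
      - specialize (Ht k H); destruct (phi (g k)) as [j y]; cbn in Ht; subst j.
        now exists y.
      - now exists (projT2 (phi (g t))). }
    exists (c i), (F i), t.
    exists (fun k => proj1_sig (constructive_indefinite_description _ (Hh k))).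
    split; [auto|split; [auto|]]; intros x y Hx Hxy.
    destruct (constructive_indefinite_description _ (Hh x)) as [u Hu]; cbn.
    destruct (constructive_indefinite_description _ (Hh y)) as [v Hv]; cbn.
    assert (Hy : ple t y) by (apply ple_trans with x; [easy|apply Hxy]).
    specialize (Hu Hx); specialize (Hv Hy); destruct (Hg x y Hxy) as [L N].
    apply Hphi in L; rewrite Hu, Hv in L; apply linear_sum_le_same in L.
    split; [easy|]; intros ->; apply N.
    rewrite <- (pp (g x)), <- (pp (g y)); congruence.
Qed.

(** Reading [n] as a Cantor pair, the first component names the element and the second counts its
    repetitions; [x0] fills in for numbers that code nothing. *)
Lemma repeating_enumeration (A : Type) (f : A -> nat) (x0 : A) :
  Injective f -> exists s : nat -> A, forall x n, exists m, n <= m /\ s m = x.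
Proof.
intros Hf.
assert (H : forall n, exists x, forall y, f y = fst (Cantor.of_nat n) -> x = y).
{ intros n; destruct (classic (exists y, f y = fst (Cantor.of_nat n))) as [[y Hy]|N].
  - exists y; intros z Hz; apply Hf; congruence.
  - exists x0; intros y Hy; destruct N; eauto. }
exists (fun n => proj1_sig (constructive_indefinite_description _ (H n))).
intros x n; exists (Cantor.to_nat (f x, n)); split.
- pose proof (Cantor.to_nat_non_decreasing (f x) n); lia.
- destruct (constructive_indefinite_description _ _) as [y Hy]; cbn.
  apply Hy; now rewrite Cantor.cancel_of_to.
Qed.

Lemma ord_lt_countable (b a : ordinal) :
  ord_lt b a -> ord_countable a -> ord_countable b.
Proof.
intros (f & x & Hf & _) [g Hg]; exists (fun y => g (f y)); intros y z E.
apply Hg in E.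
destruct (olt_total b y z) as [H|[H|H]]; [|easy|]; apply Hf in H; rewrite E in H;
  now apply olt_irrefl in H.
Qed.

Lemma omega_power_exists (a : ordinal) :
  ord_countable a -> exists C, omega_power a C.
Proof.
induction (ord_lt_wf a) as [a _ IH]; intros Ha.
destruct (classic (ord_zero a)) as [Z|NZ].
{ exists omega; split.
  - exact omega_chain.
  - apply (wf_incl _ _ lt); [intros m n; apply omega_plt|apply lt_wf].
  - now exists (fun n => n).
  - exact (inhabits 0).
  - intros n; exists (S n); apply omega_plt; lia.
  - intros D HD; apply hausdorff_class_zero; [easy|]; now right; left.
  - intros b D t g (f & x & _); now destruct (Z x). }
assert (x0 : exists x : a, True).
{ apply NNPP; intros N; apply NZ; intros x; eauto. }
destruct x0 as [x0 _]; destruct (Ha) as [f Hf].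
destruct (repeating_enumeration a f x0 Hf) as [s Hs].
assert (HB : forall n, exists C, omega_power (seg a (s n)) C).
{ intros n; apply IH; [apply seg_lt|]; apply ord_lt_countable with a; auto; apply seg_lt. }
set (F := fun n : omega => proj1_sig (constructive_indefinite_description _ (HB n))).
assert (HF : forall n, omega_power (seg a (s n)) (F n)).
{ intros n; unfold F; apply proj2_sig. }
exists (linear_sum omega F); split.
- apply linear_sum_chain; [exact omega_chain|intros n; apply (op_chain _ _ (HF n))].
- apply linear_sum_wf; [|intros n; apply (op_wf _ _ (HF n))].
  apply (wf_incl _ _ lt); [intros m n; apply omega_plt|apply lt_wf].
- pose (e := fun n => constructive_indefinite_description _ (op_countable _ _ (HF n))).
  exists (fun u => Cantor.to_nat (projT1 u, proj1_sig (e (projT1 u)) (projT2 u))).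
  intros [m x] [n y] E; apply Cantor.to_nat_inj in E; cbn in E.
  injection E as <- E; apply (proj2_sig (e m)) in E; now subst.
- destruct (op_inhabited _ _ (HF 0)) as [x]; now constructor; exists 0.
- intros [n x]; destruct (op_no_max _ _ (HF n) x) as [y [L N]].
  exists (existT _ n y); split; [now apply linear_sum_le_same|].
  intros E; now apply N, (inj_pair2 _ _ _ _ _ E).
- intros D HD.
  apply (hausdorff_class_sum a D omega F (fun n => seg a (s n))); [| | |exact HD].
  + right; left; exists (fun n => n); split; [now exists (fun n => n)|easy].
  + intros n; apply seg_lt.
  + intros n; apply (op_upper _ _ (HF n)).
    exists (fun x => x); split; [now exists (fun x => x)|easy].
- intros b D [n t] g (h & x & Hh & Hx) HD Hg.
  (* [b] is the segment of [a] below [x]. A block for this segment with index at least [S n] lies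
     wholly beyond [t], and a point [z] of the next block bounds its image. *)
  destruct (Hs x (S n)) as (m & Hm & Es).
  destruct (op_inhabited _ _ (HF (S m))) as [z].
  assert (Hin : forall y, plt (existT _ n t : linear_sum omega F) (existT _ m y)).
  { intros y; split; [apply linear_sum_le_diff, omega_plt; lia|].
    intros E; apply (f_equal (@projT1 _ _)) in E; cbn in E; lia. }
  destruct (bounded_block b (F m) D (fun y => g (existT _ m y)) (g (existT _ (S m) z)))
    as (c & E & t' & k & Hc & HE & Hk); auto.
  + apply (op_inhabited _ _ (HF m)).
  + apply (op_no_max _ _ (HF m)).
  + intros y y' [L N]; apply Hg; [apply Hin|].
    split; [now apply linear_sum_le_same|].
    intros E; now apply N, (inj_pair2 _ _ _ _ _ E).
  + intros y; apply Hg; [apply Hin|].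
    split; [apply linear_sum_le_diff, omega_plt; lia|].
    intros E; apply (f_equal (@projT1 _ _)) in E; cbn in E; lia.
  (* A tail of the block now embeds in a chain of class [c] below [b], hence below the ordinal
     [seg a x] of the block. *)
  + apply (op_lower _ _ (HF m) c E t' k); auto.
    rewrite Es; now apply (ord_lt_seg c b a h x).
Qed.

(** * Interval orders made of boxes in a chain *)

Lemma injective_unbounded (f : nat -> nat) (N : nat) :
  Injective f -> ~ forall n, f n < N.
Proof.
intros Hf Hb.
assert (H : length (map f (seq 0 (S N))) <= length (seq 0 N)).
{ apply NoDup_incl_length.
  - apply Injective_map_NoDup; [easy|apply seq_NoDup].
  - intros y Hy; apply in_map_iff in Hy as (x & <- & _); apply in_seq.
    specialize (Hb x); lia. }
rewrite length_map, !length_seq in H; lia.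
Qed.

Definition box (K : poset) (E : K -> K -> Prop) : Type :=
  {p : K * K | ple (fst p) (snd p) /\ E (fst p) (snd p)}.

Definition lft {K : poset} {E : K -> K -> Prop} (p : box K E) : K := fst (proj1_sig p).
Definition rgt {K : poset} {E : K -> K -> Prop} (p : box K E) : K := snd (proj1_sig p).

Lemma lft_le_rgt (K : poset) (E : K -> K -> Prop) (p : box K E) : ple (lft p) (rgt p).
Proof. apply (proj2_sig p). Qed.

Lemma box_eq (K : poset) (E : K -> K -> Prop) (p q : box K E) :
  lft p = lft q -> rgt p = rgt q -> p = q.
Proof.
destruct p as [[i j] Hp], q as [[i' j'] Hq]; unfold lft, rgt; cbn.
intros <- <-; f_equal; apply proof_irrelevance.
Qed.

Definition box_le {K : poset} {E : K -> K -> Prop} (p q : box K E) : Prop :=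
  p = q \/ plt (rgt p) (lft q).

Lemma box_precedes_trans (K : poset) (E : K -> K -> Prop) (p q r : box K E) :
  plt (rgt p) (lft q) -> plt (rgt q) (lft r) -> plt (rgt p) (lft r).
Proof.
intros H1 H2; apply plt_trans with (rgt q); [|easy].
apply plt_ple_trans with (lft q); [easy|apply lft_le_rgt].
Qed.

Lemma box_precedes_irrefl (K : poset) (E : K -> K -> Prop) (p : box K E) :
  ~ plt (rgt p) (lft p).
Proof. intros H; apply plt_not_ple in H; apply H, lft_le_rgt. Qed.

Lemma box_order (K : poset) (E : K -> K -> Prop) : order (box K E) box_le.
Proof.
split.
- now left.
- intros p q r [->|H1] [->|H2]; [now left|now right|now right|].
  right; now apply box_precedes_trans with q.
- intros p q [->|H1] [H2|H2]; try easy.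
  destruct (box_precedes_irrefl K E p); now apply box_precedes_trans with q.
Qed.

Definition boxes (K : poset) (E : K -> K -> Prop) : poset :=
  Poset (box K E) box_le (box_order K E).

Lemma boxes_plt (K : poset) (E : K -> K -> Prop) (p q : boxes K E) :
  plt p q <-> plt (rgt p) (lft q).
Proof.
split.
- now intros [[->|H] N].
- intros H; split; [now right|]; intros ->; now apply box_precedes_irrefl in H.
Qed.

Definition mem {K : poset} {E : K -> K -> Prop} (i : K) (p : box K E) : Prop :=
  ple (lft p) i /\ ple i (rgt p).

Lemma boxes_interval_order (K : poset) (E : K -> K -> Prop) :
  is_chain K -> interval_order (boxes K E).
Proof.
intros Hc; exists K, (fun p i => mem i p).
assert (L : forall p : box K E, mem (lft p) p /\ mem (rgt p) p).
{ intros p; pose proof (lft_le_rgt K E p); repeat split; auto using ple_refl. }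
split; [easy|split; [|split]].
(* The endpoints of each box belong to the other one. *)
- intros p q H; apply box_eq; apply ple_antisym;
    first [apply (proj2 (H _)), L|apply (proj1 (H _)), L].
- intros p; split; [exists (lft p); apply L|].
  intros x y z [Hx _] [_ Hz] Hxy Hyz; split;
    [now apply ple_trans with x|now apply ple_trans with z].
- intros p q; rewrite boxes_plt; split.
  + intros H x y [_ Hx] [Hy _].
    apply ple_plt_trans with (rgt p), plt_ple_trans with (lft q); easy.
  + intros H; apply H; apply L.
Qed.

Lemma boxes_incomparable (K : poset) (E : K -> K -> Prop) (p q : boxes K E) :
  is_chain K -> ~ plt p q -> ~ plt q p -> ple (lft p) (rgt q) /\ ple (lft q) (rgt p).
Proof.
intros Hc H1 H2; rewrite boxes_plt in *.
split; apply NNPP; intros N; apply not_ple_plt in N; auto.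
Qed.

Lemma mem_antichain (K : poset) (E : K -> K -> Prop) (i : K) :
  antichain (P := boxes K E) (mem i).
Proof.
intros p q [_ Hp] [Hq _] [->|H]; [easy|].
destruct (plt_not_ple _ _ _ H); now apply ple_trans with i.
Qed.

(* Helly's theorem: pairwise intersecting intervals share the least right endpoint. *)
Lemma antichain_common_point (K : poset) (E : K -> K -> Prop) (A : boxes K E -> Prop) :
  is_chain K -> well_founded (@plt K) -> antichain A -> (exists p, A p) ->
  exists i, forall p, A p -> mem i p.
Proof.
intros Hc Hw HA [p0 H0].
destruct (wf_minimal K (fun i => exists p, A p /\ rgt p = i) Hc Hw) as (i & (p & Ap & <-) & Hi).
- exists (rgt p0); eauto.
- exists (rgt p); intros q Aq; split; [|eauto].
  apply (boxes_incomparable K E q p Hc); intros [H N]; apply N; [now apply HA|].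
  now apply HA.
Qed.

(** A descending sequence would push right endpoints down in [K] forever. An infinite antichain
    would pass through a common point, which lies in finitely many boxes by hypothesis. *)
Lemma boxes_wqo (K : poset) (E : K -> K -> Prop) :
  is_chain K -> well_founded (@plt K) ->
  (forall i, exists (e : boxes K E -> nat) (N : nat),
     Injective e /\ forall p, mem i p -> e p < N) ->
  wqo (boxes K E).
Proof.
intros Hc Hw Hfin; split.
- intros [f Hf]; apply (no_descending K Hw).
  exists (fun n => rgt (f n)); intros n; apply plt_ple_trans with (lft (f n)).
  + now apply boxes_plt.
  + apply lft_le_rgt.
- intros [f Hf].
  destruct (antichain_common_point K E (fun p => exists n, f n = p) Hc Hw) as [i Hi].
  + intros p q [m <-] [n <-] H; destruct (Nat.eq_dec m n) as [->|N]; [easy|].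
    now destruct (Hf m n N).
  + now exists (f 0), 0.
  + destruct (Hfin i) as (e & N & He & HN).
    apply (injective_unbounded (fun n => e (f n)) N).
    * intros m n Hmn; apply He in Hmn; apply NNPP; intros H; apply (Hf m n H).
      rewrite Hmn; apply ple_refl.
    * intros n; apply HN, Hi; eauto.
Qed.


(** * Maximal antichains of boxes *)

Definition point {K : poset} {E : K -> K -> Prop} (HE : forall i, E i i) (i : K) :
  boxes K E := exist _ (i, i) (conj (ple_refl K i) (HE i)).

Lemma mem_point (K : poset) (E : K -> K -> Prop) (HE : forall i, E i i) (i : K) :
  mem i (point HE i).
Proof. split; apply ple_refl. Qed.

(** The one-point box at [i] passes through no other point. *)
Lemma mem_incl_eq (K : poset) (E : K -> K -> Prop) (i j : K) :
  (forall i, E i i) -> (forall p : boxes K E, mem i p -> mem j p) -> i = j.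
Proof.
intros HE H; now apply ple_antisym; apply (H (point HE i)), mem_point.
Qed.

(** A larger antichain has a common point [j]; all boxes through [i] then pass through [j], so
    [i = j]. *)
Lemma mem_maximal (K : poset) (E : K -> K -> Prop) (i : K) :
  is_chain K -> well_founded (@plt K) -> (forall i, E i i) ->
  maximal_antichain (P := boxes K E) (mem i).
Proof.
intros Hc Hw HE; split; [apply mem_antichain|]; intros B HB Hi p Bp.
destruct (antichain_common_point K E B Hc Hw HB) as [j Hj]; [eauto|].
rewrite (mem_incl_eq K E i j HE (fun q Hq => Hj q (Hi q Hq))); auto.
Qed.

Lemma maximal_antichain_mem (K : poset) (E : K -> K -> Prop) (A : boxes K E -> Prop) :
  is_chain K -> well_founded (@plt K) -> inhabited K -> maximal_antichain A ->
  exists i, A = mem i.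
Proof.
intros Hc Hw [i0] [HA HM].
assert (H : exists i, forall p, A p -> mem i p).
{ destruct (classic (exists p, A p)) as [H|H].
  - now apply antichain_common_point.
  (* An empty [A] is included in every [mem i], so any point will do. *)
  - exists i0; intros p Ap; destruct H; eauto. }
destruct H as [i Hi]; exists i; extensionality p; apply propositional_extensionality.
split; [apply Hi|]; apply (HM (mem i)); [apply mem_antichain|exact Hi].
Qed.

Lemma AM_boxes (K : poset) (E : K -> K -> Prop) :
  is_chain K -> well_founded (@plt K) -> inhabited K -> (forall i, E i i) ->
  order_iso (@ple (AM (boxes K E))) (@ple K).
Proof.
intros Hc Hw HK HE; apply order_iso_sym.
set (cut := fun i => exist _ (mem i) (mem_maximal K E i Hc Hw HE) : AM (boxes K E)).
assert (Hs : forall A : AM (boxes K E), exists i, proj1_sig A = mem i).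
{ intros [A HA]; now apply maximal_antichain_mem. }
exists cut; split.
- exists (fun A => proj1_sig (constructive_indefinite_description _ (Hs A))); split.
  + intros i; destruct (constructive_indefinite_description _ _) as [j Hj]; cbn in *.
    symmetry; apply (mem_incl_eq K E i j HE); now rewrite Hj.
  + intros A; destruct (constructive_indefinite_description _ _) as [j Hj]; cbn in *.
    destruct A as [A HA]; cbn in Hj; subst A; unfold cut; f_equal.
    apply proof_irrelevance.
- intros i j; split.
  + intros Hij p [Hl Hr].
    (* A box through [i] that reaches [j] is its own witness; one that stops earlier precedes the
       one-point box at [j]. *)
    destruct (classic (ple j (rgt p))) as [L|L].
    * exists p; repeat split; [now apply ple_trans with i|easy|now left].
    * apply not_ple_plt in L; [|easy].
      exists (point HE j); split; [apply mem_point|now right].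
  + intros H; destruct (H (point HE i) (mem_point K E HE i)) as (q & [Hq _] & [<-|L]).
    * exact Hq.
    * apply ple_trans with (lft q); [apply L|easy].
Qed.

(** * Modules of boxes *)

(** A box that overlaps one member of a module and is strictly comparable with another tells them
    apart, so it cannot lie outside. *)
Lemma module_overlap (K : poset) (E : K -> K -> Prop) (M : boxes K E -> Prop)
  (a b x : boxes K E) :
  module M -> M a -> M b ->
  ple (lft x) (rgt a) -> ple (lft a) (rgt x) ->
  plt (rgt x) (lft b) \/ plt (rgt b) (lft x) -> M x.
Proof.
intros HM Ma Mb Hxa Hax Hb; apply NNPP; intros N.
destruct (HM a b x Ma Mb N) as [H1 H2]; destruct Hb as [Hb|Hb].
- destruct (proj2 H1 (or_intror Hb)) as [->|L]; [easy|].
  now apply plt_not_ple in L.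
- destruct (proj2 H2 (or_intror Hb)) as [->|L]; [easy|].
  now apply plt_not_ple in L.
Qed.

Lemma module_two_points (K : poset) (E : K -> K -> Prop) (HE : forall i, E i i)
  (M : boxes K E -> Prop) (p q : boxes K E) :
  is_chain K -> module M -> M p -> M q -> p <> q ->
  exists i j, plt i j /\ M (point HE i) /\ M (point HE j).
Proof.
intros Hc HM Mp Mq N.
(* The point [rgt q] overlaps [q] and follows [p]; then the point [rgt p] overlaps [p] and precedes
   the point just obtained. *)
assert (R : forall p q : boxes K E, M p -> M q -> plt (rgt p) (rgt q) ->
  exists i j, plt i j /\ M (point HE i) /\ M (point HE j)).
{ clear p q Mp Mq N; intros p q Mp Mq L; exists (rgt p), (rgt q).
  assert (Mj : M (point HE (rgt q))).
  { apply (module_overlap K E M q p); cbn; auto using ple_refl, lft_le_rgt. }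
  repeat split; try easy; try apply L.
  apply (module_overlap K E M p (point HE (rgt q)));
    cbn; auto using ple_refl, lft_le_rgt. }
(* The point [lft p] overlaps [p] and precedes [q], which reduces this case to [R]. *)
assert (T : forall p q : boxes K E, M p -> M q -> plt (lft p) (lft q) ->
  exists i j, plt i j /\ M (point HE i) /\ M (point HE j)).
{ clear p q Mp Mq N; intros p q Mp Mq L; apply (R (point HE (lft p)) q); [|easy|].
  - apply (module_overlap K E M p q); cbn; auto using ple_refl, lft_le_rgt.
  - now apply plt_ple_trans with (lft q), lft_le_rgt. }
destruct (plt_trichotomy K (rgt p) (rgt q) Hc) as [L|[Er|L]]; eauto.
destruct (plt_trichotomy K (lft p) (lft q) Hc) as [L|[El|L]]; eauto.
now destruct N; apply box_eq.
Qed.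

(** * Linked boxes: finiteness at each point and primality *)

(** The second clause says that [i] is l(j); a relation is used because l(j) need not exist. The
    first clause admits the one-point boxes. *)
Definition link {K : poset} (idx : K -> nat) (i j : K) : Prop :=
  i = j \/
  (plt i j /\ idx i < idx j /\ forall k, plt k j -> idx k < idx j -> ple k i).

Lemma link_refl (K : poset) (idx : K -> nat) (i : K) : link idx i i.
Proof. now left. Qed.

(** Injectivity leaves at most one element of [Q] with the top index, so the induction only compares
    it with the previous maximum. *)
Lemma bounded_maximum (K : poset) (idx : K -> nat) (Q : K -> Prop) (n : nat) :
  is_chain K -> Injective idx -> (exists k, Q k) -> (forall k, Q k -> idx k < n) ->
  exists m, Q m /\ forall k, Q k -> ple k m.
Proof.
intros Hc Hi; revert Q; induction n as [|n IH]; intros Q [x Qx] Hb.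
- specialize (Hb x Qx); lia.
- destruct (classic (exists k, Q k /\ idx k < n)) as [HQ|N].
  + destruct (IH (fun k => Q k /\ idx k < n) HQ) as (m & [Qm _] & Hm); [easy|].
    destruct (classic (exists k, Q k /\ plt m k)) as [(k & Qk & L)|H].
    * exists k; split; [easy|]; intros y Qy.
      destruct (Nat.lt_ge_cases (idx y) n) as [Hy|Hy].
      -- apply ple_trans with m; [auto|apply L].
      -- destruct (Nat.lt_ge_cases (idx k) n) as [Hk|Hk];
           [now apply plt_not_ple in L; destruct L; apply Hm|].
         replace y with k; [apply ple_refl|].
         apply Hi; specialize (Hb y Qy) as H1; specialize (Hb k Qk) as H2; lia.
    * exists m; split; [easy|]; intros y Qy; apply NNPP; intros L.
      apply H; exists y; split; [easy|now apply not_ple_plt].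
  + exists x; split; [easy|]; intros y Qy.
    replace y with x; [apply ple_refl|]; apply Hi.
    assert (H : forall k, Q k -> idx k = n).
    { intros k Qk; specialize (Hb k Qk).
      destruct (Nat.lt_ge_cases (idx k) n); [destruct N; eauto|lia]. }
    now rewrite !H.
Qed.

Lemma link_exists (K : poset) (idx : K -> nat) (i j : K) :
  is_chain K -> Injective idx -> plt i j -> idx i < idx j ->
  exists l, plt l j /\ link idx l j.
Proof.
intros Hc Hi L Hij.
destruct (bounded_maximum K idx (fun k => plt k j /\ idx k < idx j) (idx j) Hc Hi)
  as (l & [H1 H2] & Hl); [eauto|easy|].
exists l; split; [easy|right]; auto.
Qed.

Lemma chain_successor (K : poset) (i : K) :
  is_chain K -> well_founded (@plt K) -> (forall x : K, exists y, plt x y) ->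
  exists s, plt i s /\ forall k, plt i k -> ple s k.
Proof. intros Hc Hw Hn; now apply (wf_minimal K (plt i)). Qed.

(* A box ending after the successor [s] of [i], with a right endpoint of larger
   index than [s], starts at [s] or later. *)
Lemma link_point_finite (K : poset) (idx : K -> nat) (i : K) :
  is_chain K -> well_founded (@plt K) -> (forall x : K, exists y, plt x y) ->
  Injective idx ->
  exists (e : boxes K (link idx) -> nat) (N : nat),
    Injective e /\ forall p, mem i p -> e p < N.
Proof.
intros Hc Hw Hn Hi; destruct (chain_successor K i Hc Hw Hn) as (s & Hs & Hmin).
set (B := Nat.max (idx i) (idx s)).
exists (fun p => Cantor.to_nat (idx (lft p), idx (rgt p))).
(* Both endpoints of a box through [i] have index at most [B]. Twice the Cantor code of (x, y) is 2y
   + (x + y)(x + y + 1), bounded here without halving. *)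
exists (S (B * 2 + (B + B) * S (B + B))); split.
- intros p q H; apply Cantor.to_nat_inj in H; injection H as H1 H2.
  apply box_eq; now apply Hi.
- intros p [Hl Hr].
  assert (H : idx (lft p) <= idx (rgt p) /\ idx (rgt p) <= B).
  { destruct (proj2 (proj2_sig p)) as [Ep|(L & HL & Hm)];
      fold (lft p) (rgt p) in *.
    - rewrite <- Ep in *; rewrite (ple_antisym K _ _ Hl Hr); lia.
    - split; [lia|]; apply ple_eq_or_plt in Hr as [<-|Hr]; [lia|].
      pose proof (Hmin _ Hr) as H; apply ple_eq_or_plt in H as [<-|H]; [lia|].
      destruct (Nat.lt_ge_cases (idx s) (idx (rgt p))) as [Hlt|Hge]; [|lia].
      destruct (plt_not_ple _ _ _ Hs).
      apply ple_trans with (lft p); [now apply Hm|easy]. }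
  pose proof (Cantor.to_nat_spec (idx (lft p)) (idx (rgt p))); nia.
Qed.

Lemma index_at_zero (A : Type) (f : A -> nat) (z : A) :
  Injective f -> exists g : A -> nat,
    Injective g /\ g z = 0 /\ forall x, x <> z -> g x = S (f x).
Proof.
intros Hf.
exists (fun x => if excluded_middle_informative (x = z) then 0 else S (f x)).
repeat split.
- intros x y; do 2 destruct excluded_middle_informative; subst; try easy.
  intros E; apply Hf; congruence.
- now destruct excluded_middle_informative.
- intros x N; now destruct excluded_middle_informative.
Qed.

(** A module with two members contains two points; links carry it down to [z], then up to all
    points, and thence to all boxes. Index 0 at [z] gives every other point a link, and index 1 at
    [o] makes [o] the only other point linked to [z]. *)
Lemma link_prime (K : poset) (idx : K -> nat) (z o : K) :
  is_chain K -> well_founded (@plt K) -> (forall x : K, exists y, plt x y) ->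
  Injective idx ->
  (forall x, ple z x) -> plt z o -> (forall x, plt z x -> ple o x) ->
  idx z = 0 -> idx o = 1 ->
  prime (boxes K (link idx)).
Proof.
intros Hc Hw Hn Hi Hz Hzo Ho Iz Io M HM.
destruct (classic (exists p q, M p /\ M q /\ p <> q)) as [(p & q & Mp & Mq & N)|N].
2:{ destruct (classic (exists p, M p)) as [[p Mp]|H]; [|left; eauto].
    right; left; exists p; intros q; split; [|now intros ->].
    intros Mq; apply NNPP; intros H; apply N; eauto. }
right; right.
pose (pt := point (link_refl K idx)).
assert (Hlink : forall j, plt z j -> exists l, plt l j /\ link idx l j).
{ intros j L; apply (link_exists K idx z j); auto; rewrite Iz.
  destruct (idx j) eqn:Ej; [|lia].
  rewrite (Hi j z) in L by congruence; now apply plt_irrefl in L. }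
destruct (module_two_points K _ (link_refl K idx) M p q Hc HM Mp Mq N)
  as (i & j & Lij & Mi & Mj); fold pt in Mi, Mj.
(* If the least point [m] of the module were not [z], its link box [J] would overlap [m] and precede
   [j]; then the point [l] overlaps [J] and precedes [m], so it would be a smaller one. *)
assert (Mz : M (pt z)).
{ destruct (wf_minimal K (fun k => M (pt k)) Hc Hw) as (m & Mm & Hm); [eauto|].
  destruct (ple_eq_or_plt K z m (Hz m)) as [->|Lm]; [easy|exfalso].
  destruct (Hlink m Lm) as (l & Ll & Hl).
  pose (J := exist _ (l, m) (conj (proj1 Ll) Hl) : boxes K (link idx)).
  assert (MJ : M J).
  { apply (module_overlap K _ M (pt m) (pt j)); cbn; auto using ple_refl.
    - apply Ll.
    - left; apply ple_plt_trans with i; auto. }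
  apply (plt_not_ple _ _ _ Ll), Hm.
  apply (module_overlap K _ M J (pt m)); cbn; auto using ple_refl.
  apply Ll. }
assert (Lzj : plt z j) by (apply ple_plt_trans with i; auto).
assert (Mpt : forall k, M (pt k)).
{ intros k; induction (Hw k) as [n _ IH].
  destruct (ple_eq_or_plt K z n (Hz n)) as [->|Ln]; [easy|].
  apply NNPP; intros Nn.
  destruct (Hlink n Ln) as (l & Ll & Hl).
  (* To bring in [J] and then [n], a point [b] of the module off [J] is needed: [z] if [l] is not
     [z]; otherwise [n] is [o], and [j] lies beyond it. *)
  assert (Hb : exists b, M (pt b) /\ (plt n b \/ plt b l)).
  { destruct (ple_eq_or_plt K z l (Hz l)) as [<-|Lzl]; [|eauto].
    (* Beyond [o] all indices exceed 1, so [o] competes for the link, which cannot fall back to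
       [z]. *)
    assert (Lno : ple n o).
    { apply NNPP; intros L; apply not_ple_plt in L; [|easy].
      destruct Hl as [->|(_ & _ & Hm)]; [now apply plt_irrefl in Ll|].
      apply (plt_not_ple _ _ _ Hzo), Hm; [easy|].
      rewrite Io; destruct (idx n) as [|[|k]] eqn:En; [| |lia].
      - rewrite (Hi n z) in Ln by congruence; now apply plt_irrefl in Ln.
      - rewrite (Hi n o) in L by congruence; now apply plt_irrefl in L. }
    exists j; split; [easy|left; split].
    - apply ple_trans with o; auto.
    - intros <-; easy. }
  destruct Hb as (b & Mb & Hb).
  pose (J := exist _ (l, n) (conj (proj1 Ll) Hl) : boxes K (link idx)).
  apply Nn, (module_overlap K _ M J (pt b)); cbn; auto using ple_refl.
  - apply (module_overlap K _ M (pt l) (pt b)); cbn; auto using ple_refl.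
    apply Ll.
  - apply Ll.
  - destruct Hb as [Hb|Hb]; [left; apply Hb|right].
    now apply plt_trans with l. }
(* Any box overlaps the point at its right end and precedes some later point. *)
intros r; destruct (Hn (rgt r)) as [s Hs].
apply (module_overlap K _ M (pt (rgt r)) (pt s));
  cbn; auto using ple_refl, lft_le_rgt.
Qed.

Theorem theorem1p5 (a : ordinal) (ha : ord_countable a) :
  exists P : poset,
    wqo P /\ prime P /\ interval_order P /\ hausdorff_rank (AM P) a.
Proof.
destruct (omega_power_exists a ha) as [K [Hc Hw [f0 H0] HK Hn Hup Hlow]].
destruct (wf_minimal K (fun _ => True) Hc Hw) as (z & _ & Hz).
{ destruct HK as [x]; now exists x. }
destruct (chain_successor K z Hc Hw Hn) as (o & Hzo & Ho).
(* The order matters: renumbering [z] last shifts [o] from 0 to 1. *)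
destruct (index_at_zero K f0 o H0) as (f1 & H1 & E1 & _).
destruct (index_at_zero K f1 z H1) as (idx & Hi & Iz & Iidx).
assert (Io : idx o = 1).
{ rewrite Iidx, E1; [easy|]; intros ->; now apply plt_irrefl in Hzo. }
pose proof (AM_boxes K (link idx) Hc Hw HK (link_refl K idx)) as HA.
exists (boxes K (link idx)); split; [|split; [|split]].
- apply boxes_wqo; auto; intros i; now apply link_point_finite.
- apply (link_prime K idx z o); auto.
- now apply boxes_interval_order.
- destruct (HA) as (phi & (psi & pp & qq) & Hphi).
  assert (Hlt : forall A B, plt A B -> plt (phi A) (phi B)).
  { intros A B [L N]; split; [now apply Hphi|].
    intros E; apply N; rewrite <- (pp A), <- (pp B); congruence. }
  assert (Hlt' : forall x y, plt x y -> plt (psi x) (psi y)).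
  { intros x y [L N]; split; [apply Hphi; now rewrite !qq|].
    intros E; apply N; rewrite <- (qq x), <- (qq y); congruence. }
  split; [|split].
  + apply wf_chain_scattered.
    * intros A B; rewrite !Hphi; apply Hc.
    * apply (wf_incl _ _ (fun A B => plt (phi A) (phi B))); [exact Hlt|].
      now apply wf_inverse_image.
  + now apply Hup.
  (* If the maximal antichains formed a chain of class [b], then [psi] would embed [K] in it; the
     tail from the least point [z] is all of [K]. *)
  + intros b Hb HD; apply (Hlow b _ z psi Hb HD); intros x y _; apply Hlt'.
Qed.
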